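(* Let $R$ be a unital non-associative ring, let $G$ be a commutative monoid, and let $S=R[G;\pi]$ be a differential monoid ring (i.e. $\pi$ satisfies (D0)--(D4) and (D6)) such that $\pi$ is strong (i.e. (D7) or (D8) holds) and well-ordered. Suppose that (D8) holds, or that (D7) holds and $\pi$ is commutative. Then $S$ is $G$-simple if and only if $R$ is $G$-simple and $Z(S)^G$ is a field.
   Context: ''Non-associative'' means not necessarily associative: a unital non-associative ring is an additive abelian group with a biadditive multiplication and a two-sided identity $1$. Ideals are two-sided. $G$ is a monoid with identity $e$, and $\pi=\{\pi^a_b\}_{a,b\in G}$ is a family of maps $\pi^a_b:R\to R$. Consider the axioms: (D0) for all $a\in G$, $r\in R$, $\pi^a_b(r)=0$ for all but finitely many $b\in G$; (D1) $\pi^e_e=\mathrm{id}_R$, and $\pi^e_a=0$ for all $a\in G\setminus\{e\}$; (D2) $\pi^a_b(1)=\delta_{a,b}$ (Kronecker delta) for all $a,b\in G$; (D3) each $\pi^a_b$ is additive; (D4) $\pi^{ab}_c=\sum_{(d,f)\in G\times G,\ df=c}\pi^a_d\circ\pi^b_f$ for all $a,b,c\in G$; (D6) $\pi^a_a=\mathrm{id}_R$ for all $a\in G$; (D7) each $\pi^a_b$ is left $R^G$-linear, i.e. $\pi^a_b(kr)=k\pi^a_b(r)$ for $k\in R^G$, $r\in R$; (D8) each $\pi^a_b$ is right $R^G$-linear, i.e. $\pi^a_b(rk)=\pi^a_b(r)k$ for $k\in R^G$, $r\in R$. Here $R^G=\{r\in R\mid \pi^a_b(r)=\delta_{a,b}r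 \text{ for all } a,b\in G\}$. When (D0)--(D4) hold, $S=R[G;\pi]$ is the set of formal sums $\sum_{a\in G}r_ax^a$ ($r_a\in R$, zero for all but finitely many $a$) with pointwise addition and biadditive multiplication determined by $(rx^a)(sx^b)=\sum_{c\in G}r\pi^a_c(s)x^{cb}$; it is called an Ore monoid ring, and a differential monoid ring if (D6) also holds. Each $\pi^a_b$ is extended to an additive map $\tilde\pi^a_b:S\to S$ by $\tilde\pi^a_b(rx^c)=\pi^a_b(r)x^c$. Put $S^G=\{s\in S\mid\tilde\pi^a_b(s)=\delta_{a,b}s\text{ for all }a,b\in G\}=\sum_{a\in G}R^Gx^a$. The center $Z(S)$ is the set of $s\in S$ with $st=ts$ and $(s,t,u)=(t,s,u)=(t,u,s)=0$ for all $t,u\in S$, where $(u,v,w)=(uv)w-u(vw)$. Put $Z(S)^G=Z(S)\cap S^G$. An ideal $J$ of $R$ (respectively $S$) is $G$-invariant if $\pi^a_b(J)\subseteq J$ (respectively $\tilde\pi^a_b(J)\subseteq J$) for all $a,b\in G$; $R$ (respectively $S$) is $G$-simple if its only $G$-invariant ideals are $\{0\}$ and the whole ring. $\pi$ is commutative if $\pi^a_b\circ\pi^c_d=\pi^c_d\circ\pi^a_b$ for all $a,b,c,d\in G$. $\pi$ is well-ordered if there is a well-order $\preceq$ on $G$ such that $\pi^a_b=0$ whenever $a\prec b$ (i.e. $a\preceq b$ and $a\ne b$).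
   Formalization: The ring R is assumed to be nonzero (1 ≠ 0): for R = 0 the ring S = 0 is G-simple in the stated sense, but Z(S)^G = 0 is not a field. *)

(* Defs.v *)
From HB Require Import structures.
From mathcomp Require Import all_boot all_order all_algebra.
From mathcomp Require Import finmap.
From mathcomp Require Import boolp classical_sets cardinality fsbigop wochoice.
From mathcomp.multinomials Require Import monalg.

Set Implicit Arguments.
Unset Strict Implicit.
Unset Printing Implicit Defensive.

Import GRing.Theory.
Local Open Scope classical_set_scope.
Local Open Scope ring_scope.
Local Open Scope group_scope.

Local Notation "x ** y" := (@monoid.mul _ x y) (at level 40, left associativity).

(* Unital, not necessarily associative rings; the zero ring is allowed.
   The product and the unit are those of monoid.v; addition is that of ssralg. *)
HB.mixin Record isNARing R of GRing.Zmodule R & UMagma R := {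
  namulDl : left_distributive (@monoid.mul R) (@GRing.add R);
  namulDr : right_distributive (@monoid.mul R) (@GRing.add R)
}.

#[short(type="naRingType")]
HB.structure Definition NARing :=
  {R of GRing.Zmodule R & UMagma R & isNARing R}.

Section NARingTheory.
Variable R : naRingType.
Implicit Types (x y z : R) (J K : set R).

Lemma namul0r x : 0 ** x = 0 :> R.
Proof. by apply: (@addrI R (0 ** x)); rewrite -namulDl !addr0. Qed.

Lemma namulr0 x : x ** 0 = 0 :> R.
Proof. by apply: (@addrI R (x ** 0)); rewrite -namulDr !addr0. Qed.

Definition associator x y z : R := (x ** y) ** z - x ** (y ** z).

Definition center : set R :=
  [set s | forall t u : R,
     [/\ s ** t = t ** s, associator s t u = 0,
         associator t s u = 0 & associator t u s = 0]].

Definition na_ideal J :=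
  [/\ J 0, forall x y, J x -> J y -> J (x - y),
      forall r x, J x -> J (r ** x) & forall r x, J x -> J (x ** r)].

(* K is a field for the operations of R *)
Definition is_subfield K :=
  [/\ K 1%g /\ 1%g <> 0 :> R,
      forall x y, K x -> K y -> K (x - y) /\ K (x ** y),
      forall x y z, K x -> K y -> K z -> x ** (y ** z) = (x ** y) ** z,
      forall x y, K x -> K y -> x ** y = y ** x
    & forall x, K x -> x <> 0 -> exists y, K y /\ x ** y = 1%g].

End NARingTheory.

(* Used for phi = pi on R and for its extension to the Ore monoid ring. *)
Section FamilyOfMaps.
Variables (T : naRingType) (G : monoidType) (phi : G -> G -> T -> T).

Definition invariants : set T :=
  [set r | forall a b, phi a b r = if a == b then r else 0].

Definition G_invariant (J : set T) :=
  forall (a b : G) (r : T), J r -> J (phi a b r).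

Definition G_simple :=
  forall J : set T, na_ideal J -> G_invariant J -> J = [set 0] \/ J = setT.

End FamilyOfMaps.

Section FamilyConditions.
Variables (R : naRingType) (G : monoidType) (pi : G -> G -> R -> R).

Definition axiomD0 :=
  forall (a : G) (r : R), finite_set [set b | pi a b r <> 0].

Definition axiomD1 :=
  (forall r, pi 1 1 r = r) /\ (forall a, a <> 1 -> forall r, pi 1 a r = 0).

Definition axiomD2 := forall a b, pi a b 1%g = if a == b then 1%g else 0.

Definition axiomD3 := forall a b (r s : R), pi a b (r + s) = pi a b r + pi a b s.

(* \sum_(_ \in _) runs over the support of the summand, finite by D0 and D3. *)
Definition axiomD4 := forall (a b c : G) (r : R),
  pi (a * b) c r =
  \sum_(df \in [set df : G * G | df.1 * df.2 = c]) pi a df.1 (pi b df.2 r).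

Definition axiomD6 := forall a r, pi a a r = r.

Definition axiomD7 := forall (a b : G) (k r : R),
  invariants pi k -> pi a b (k ** r) = k ** pi a b r.

Definition axiomD8 := forall (a b : G) (k r : R),
  invariants pi k -> pi a b (r ** k) = pi a b r ** k.

Definition strong := axiomD7 \/ axiomD8.

Definition commutative_family := forall (a b c d : G) (r : R),
  pi a b (pi c d r) = pi c d (pi a b r).

Definition well_ordered := exists2 le : rel G,
  wochoice.well_order le
  & forall a b, le a b -> a <> b -> forall r, pi a b r = 0.

End FamilyConditions.

Record oreFamily (R : naRingType) (G : monoidType) := OreFamily {
  ore_map :> G -> G -> R -> R;
  oreD0 : axiomD0 ore_map;
  oreD1 : axiomD1 ore_map;
  oreD2 : axiomD2 ore_map;
  oreD3 : axiomD3 ore_map;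
  oreD4 : axiomD4 ore_map
}.

(* The Ore monoid ring R[G; pi]; << r *g a >> stands for the monomial r x^a. *)
Definition oreRing (R : naRingType) (G : monoidType) (pi : oreFamily R G)
  : Type := {malg R[G]}.

Section OreRing.
Variables (R : naRingType) (G : monoidType) (pi : oreFamily R G).
Local Notation S := (oreRing pi).
Local Notation M := {malg R[G]}.

HB.instance Definition _ := GRing.Zmodule.copy S M.

Definition ore_mulU (r : R) (a : G) (s : R) (b : G) : M :=
  \sum_(c \in [set: G]) << r ** pi a c s *g (c * b)%g >>.

Definition ore_mul (s t : S) : S :=
  \sum_(a <- msupp s) \sum_(b <- msupp t) ore_mulU s@_a a t@_b b.

Definition ore_one : S := << 1%g *g 1%g >>.

Lemma ore_map0 a b : pi a b 0 = 0.
Proof. by apply: (@addrI R (pi a b 0)); rewrite -oreD3 !addr0. Qed.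

Lemma ore_supp a s : exists X : {fset G}, forall c, c \notin X -> pi a c s = 0.
Proof.
have /finite_fsetP[X eX] := oreD0 pi a s; exists X => c cX.
have [//|/eqP nz] := eqVneq (pi a c s) 0.
suff : [set` X] c by rewrite /= (negPf cX).
by rewrite -eX.
Qed.

Lemma ore_mulUE r a s b (X : {fset G}) : (forall c, c \notin X -> pi a c s = 0) ->
  ore_mulU r a s b = \sum_(c <- X) << r ** pi a c s *g (c * b)%g >>.
Proof.
by move=> Xs; rewrite /ore_mulU (fsbigTE X)// => c /Xs ->; rewrite namulr0 monalgU0.
Qed.

Lemma ore_mulU0l a s b : ore_mulU 0 a s b = 0.
Proof.
have [X Xs] := ore_supp a s; rewrite (ore_mulUE _ _ Xs).
by rewrite big1 // => c _; rewrite namul0r monalgU0.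
Qed.

Lemma ore_mulU0r r a b : ore_mulU r a 0 b = 0.
Proof.
rewrite (@ore_mulUE _ _ _ _ fset0) => [|c _]; last exact: ore_map0.
by rewrite big_seq_fset0.
Qed.

Lemma ore_mulUDl r1 r2 a s b :
  ore_mulU (r1 + r2) a s b = ore_mulU r1 a s b + ore_mulU r2 a s b.
Proof.
have [X Xs] := ore_supp a s; rewrite !(ore_mulUE _ _ Xs) -big_split /=.
by apply: eq_bigr => c _; rewrite namulDl monalgUD.
Qed.

Lemma ore_mulUDr r a s1 s2 b :
  ore_mulU r a (s1 + s2) b = ore_mulU r a s1 b + ore_mulU r a s2 b.
Proof.
have [X1 Xs1] := ore_supp a s1; have [X2 Xs2] := ore_supp a s2.
have X1s c : c \notin (X1 `|` X2)%fset -> pi a c s1 = 0.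
  by rewrite in_fsetU negb_or => /andP[/Xs1].
have X2s c : c \notin (X1 `|` X2)%fset -> pi a c s2 = 0.
  by rewrite in_fsetU negb_or => /andP[_ /Xs2].
have Xs c : c \notin (X1 `|` X2)%fset -> pi a c (s1 + s2) = 0.
  by move=> cX; rewrite oreD3 X1s // X2s // addr0.
rewrite (ore_mulUE _ _ X1s) (ore_mulUE _ _ X2s) (ore_mulUE _ _ Xs) -big_split /=.
by apply: eq_bigr => c _; rewrite oreD3 namulDr monalgUD.
Qed.

Lemma ore_mulEw (s t : S) (A B : {fset G}) :
  (msupp s `<=` A)%fset -> (msupp t `<=` B)%fset ->
  ore_mul s t = \sum_(a <- A) \sum_(b <- B) ore_mulU s@_a a t@_b b.
Proof.
move=> sA tB; rewrite /ore_mul.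
rewrite (big_fset_incl _ sA) => [|a _ sa].
  apply: eq_bigr => a _; apply: (big_fset_incl _ tB) => b _ tb.
  by rewrite (mcoeff_outdom tb) ore_mulU0r.
by rewrite big1 // => b _; rewrite (mcoeff_outdom sa) ore_mulU0l.
Qed.

Lemma ore_mulUU r a s b : ore_mul << r *g a >> << s *g b >> = ore_mulU r a s b.
Proof.
rewrite (ore_mulEw msuppU_le msuppU_le) !big_seq_fset1.
by rewrite !mcoeffUU.
Qed.

Lemma ore_mulDl : left_distributive ore_mul +%R.
Proof.
move=> s1 s2 t; set A := (msupp s1 `|` msupp s2)%fset.
have A1 : (msupp s1 `<=` A)%fset by exact: fsubsetUl.
have A2 : (msupp s2 `<=` A)%fset by exact: fsubsetUr.
rewrite (ore_mulEw (msuppD_le s1 s2) (fsubset_refl (msupp t))).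
rewrite (ore_mulEw A1 (fsubset_refl (msupp t))).
rewrite (ore_mulEw A2 (fsubset_refl (msupp t))) -big_split.
apply: eq_bigr => a _; rewrite -big_split; apply: eq_bigr => b _ /=.
by rewrite -ore_mulUDl mcoeffD.
Qed.

Lemma ore_mulDr : right_distributive ore_mul +%R.
Proof.
move=> s t1 t2; set B := (msupp t1 `|` msupp t2)%fset.
have B1 : (msupp t1 `<=` B)%fset by exact: fsubsetUl.
have B2 : (msupp t2 `<=` B)%fset by exact: fsubsetUr.
rewrite (ore_mulEw (fsubset_refl (msupp s)) (msuppD_le t1 t2)).
rewrite (ore_mulEw (fsubset_refl (msupp s)) B1).
rewrite (ore_mulEw (fsubset_refl (msupp s)) B2) -big_split.
apply: eq_bigr => a _; rewrite -big_split; apply: eq_bigr => b _ /=.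
by rewrite -ore_mulUDr mcoeffD.
Qed.

Lemma ore_mul1s : left_id ore_one ore_mul.
Proof.
move=> t; rewrite (ore_mulEw msuppU_le (fsubset_refl (msupp t))).
rewrite big_seq_fset1 [RHS]monalgE; apply: eq_bigr => b _.
have [D1 D1'] := oreD1 pi.
rewrite (@ore_mulUE _ _ _ _ [fset 1%g]%fset) => [|c].
  by rewrite big_seq_fset1 mcoeffUU D1 !mul1g.
by rewrite in_fset1 => /eqP /D1'.
Qed.

Lemma ore_muls1 : right_id ore_one ore_mul.
Proof.
move=> s; rewrite (ore_mulEw (fsubset_refl (msupp s)) msuppU_le).
rewrite [RHS]monalgE; apply: eq_bigr => a _; rewrite big_seq_fset1 mcoeffUU.
rewrite (@ore_mulUE _ _ _ _ [fset a]%fset) => [|c].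
  by rewrite big_seq_fset1 (oreD2 pi) eqxx !mulg1.
by rewrite in_fset1 eq_sym (oreD2 pi) => /negPf ->.
Qed.

HB.instance Definition _ := hasMul.Build S ore_mul.
HB.instance Definition _ := Magma_isUMagma.Build S ore_mul1s ore_muls1.
HB.instance Definition _ := isNARing.Build S ore_mulDl ore_mulDr.

(* The maps \tilde pi^a_b *)
Definition ore_ext (a b : G) (s : S) : S :=
  \sum_(c <- msupp s) << pi a b s@_c *g c >>.

Lemma ore_extE a b (s : S) (c : G) :
  mcoeff c (ore_ext a b s) = pi a b (mcoeff c s).
Proof.
rewrite /ore_ext raddf_sum /=; case: (msuppP s c) => sc.
  rewrite (big_fsetD1 c) //= mcoeffUU big1_fset ?addr0 // => c'.
  by rewrite in_fsetD1 mcoeffU => /andP[/negPf ->].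
rewrite big1_fset ?ore_map0 // => c' c's _; rewrite mcoeffU.
by case: eqP c's sc => // -> ->.
Qed.

Lemma ore_extU a b r (c : G) :
  ore_ext a b << r *g c >> = << pi a b r *g c >>.
Proof.
apply/malgP => d; rewrite ore_extE !mcoeffU.
by case: eqP => _ //; rewrite mulr0n ore_map0.
Qed.

(* Z(S)^G *)
Definition invariant_center : set S := @center S `&` invariants ore_ext.

End OreRing.

(* Main.v *)
Require Import Defs.
From mathcomp Require Import all_boot all_order all_algebra.
From mathcomp Require Import finmap.
From mathcomp Require Import boolp classical_sets fsbigop wochoice.
From mathcomp.multinomials Require Import monalg.

(** Write S = R[G; pi] and let K be the set of central invariant elements of S.

    Suppose S is G-simple.  If J is a G-invariant ideal of R, the elements of
    S with all coefficients in J form a G-invariant ideal of S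
    ([coefficientwise_ideal]), so J is trivial; hence R is G-simple.  If s is
    a nonzero element of K, the ideal S s is G-invariant because the extended
    maps are right linear over K ([ore_ext_mul_comm]; this is where D8, or D7
    with commutativity, enters).  So S s = S, s has an inverse t, and t is
    again central ([center_inv]) and invariant.

    Conversely let R be G-simple, K a field and I a nonzero G-invariant ideal
    of S.  The well-order gives every nonzero element of S a leading monomial.
    Since pi^a_b = 0 for a < b and pi^a_a = id, multiplying on either side by
    a scalar r of R, or applying an extended map, never raises the degree and
    acts on the leading coefficient in the obvious way.  Hence the leading
    coefficients of the elements of I of least degree a form, with 0, a
    nonzero G-invariant ideal of R, which must be R: some s in I has degree a
    and leading coefficient 1 ([minimal_monic]).  Every expression that ought
    to vanish for a central invariant s, such as r s - s r or
    (r r') s - r (r' s), lies in I and has lower degree, so it is 0 by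
    minimality.

    That only tests s against scalars.  The passage to all of S
    ([center_of_scalars]) rests on the powers x^b lying in the right and the
    middle nucleus of S ([X_right_nucleus], [X_middle_nucleus]): each element
    of S is a sum of products r x^b, and the powers can be moved out of any
    associator except (x^b, u, s).  That last one vanishes because
    x^b u = sum_f pi~^b_f(u) x^f over the commutative monoid G
    ([mulX_ext]) and the maps pi~^b_f are right linear over s.  So s is a
    nonzero element of the field K; it is invertible, and I = S. *)

Set Implicit Arguments.
Unset Strict Implicit.
Unset Printing Implicit Defensive.

Import GRing.Theory.
Local Open Scope classical_set_scope.
Local Open Scope ring_scope.
Local Open Scope group_scope.

Local Notation "x ** y" := (@monoid.mul _ x y) (at level 40, left associativity).

(** * Centers and ideals of non-associative rings *)

Section NonAssociativeRing.
Variable T : naRingType.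
Implicit Types (s t u v : T) (J : set T).

Lemma namul_suml (I : Type) (r : seq I) (F : I -> T) t :
  (\sum_(i <- r) F i) ** t = \sum_(i <- r) (F i ** t).
Proof. exact: (big_morph (fun s => s ** t) (fun x y => namulDl x y t) (namul0r t)). Qed.

Lemma namul_sumr (I : Type) (r : seq I) (F : I -> T) t :
  t ** (\sum_(i <- r) F i) = \sum_(i <- r) (t ** F i).
Proof. exact: (big_morph (fun s => t ** s) (namulDr t) (namulr0 t)). Qed.

Lemma namulNl s t : (- s) ** t = - (s ** t).
Proof. by apply: (@addrI T (s ** t)); rewrite -namulDl !subrr namul0r. Qed.

Lemma namulNr s t : s ** (- t) = - (s ** t).
Proof. by apply: (@addrI T (s ** t)); rewrite -namulDr !subrr namulr0. Qed.

Lemma namulBl s t u : (s - t) ** u = s ** u - t ** u.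
Proof. by rewrite namulDl namulNl. Qed.

Lemma namulBr s t u : s ** (t - u) = s ** t - s ** u.
Proof. by rewrite namulDr namulNr. Qed.

Lemma centerC s t : center s -> s ** t = t ** s.
Proof. by move=> /(_ t 0)[]. Qed.

Lemma centerAl s t u : center s -> s ** t ** u = s ** (t ** u).
Proof. by move=> /(_ t u)[_ /subr0_eq]. Qed.

Lemma centerAm s t u : center s -> t ** s ** u = t ** (s ** u).
Proof. by move=> /(_ t u)[_ _ /subr0_eq]. Qed.

Lemma centerAr s t u : center s -> t ** u ** s = t ** (u ** s).
Proof. by move=> /(_ t u)[_ _ _ /subr0_eq]. Qed.

(** Two of the three associator conditions suffice: moving s across by
    commutativity turns the middle associator (t, s, u) into the outer ones. *)
Lemma center_intro s :
    (forall t, s ** t = t ** s) ->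
    (forall t u, s ** t ** u = s ** (t ** u)) ->
    (forall t u, t ** u ** s = t ** (u ** s)) ->
  center s.
Proof.
move=> sC sAl sAr t u; split; rewrite /associator ?sAl ?sAr ?subrr //.
by rewrite -sC sAl sC sAr -sC subrr.
Qed.

Lemma center_one : center (1%g : T).
Proof.
by apply: center_intro => [t|t u|t u]; rewrite !(mul1g, mulg1).
Qed.

Lemma center_sub s t : center s -> center t -> center (s - t).
Proof.
move=> cs ct; apply: center_intro => [u|u v|u v]; rewrite !(namulBl, namulBr).
- by rewrite (centerC u cs) (centerC u ct).
- by rewrite (centerAl u v cs) (centerAl u v ct).
- by rewrite (centerAr u v cs) (centerAr u v ct).
Qed.

Lemma center_mul s t : center s -> center t -> center (s ** t).
Proof.
move=> cs ct; apply: center_intro => [u|u v|u v].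
- by rewrite (centerAl t u cs) (centerC u ct) -(centerAl u t cs) (centerC u cs)
    (centerAm u t cs).
- by rewrite !(centerAl _ _ cs) (centerAl _ _ ct).
- by rewrite -(centerAr _ _ ct) (centerAr u v cs) (centerAr u _ ct)
    (centerAr v s ct).
Qed.

(** Left multiplication by s is injective, so each law for t can be checked
    after multiplying by s, which cancels t. *)
Lemma center_inv s t : center s -> s ** t = 1 -> center t.
Proof.
move=> cs st; have sI u v : s ** u = s ** v -> u = v.
  by move=> /(congr1 (fun x => t ** x)); rewrite -!(centerAm _ _ cs)
    -(centerC t cs) st !mul1g.
apply: center_intro => [u|u v|u v]; apply: sI.
- by rewrite -(centerAl _ _ cs) st -(centerAl _ _ cs) (centerC u cs)
    (centerAm _ _ cs) st mulg1 mul1g.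
- by rewrite -!(centerAl _ _ cs) st !mul1g.
- by rewrite -(centerAl _ t cs) (centerC (u ** v) cs) (centerAm _ _ cs) st
    -(centerAl _ _ cs) (centerC u cs) (centerAm _ _ cs) -(centerAl _ _ cs)
    (centerC v cs) (centerAm _ _ cs) st !mulg1.
Qed.

Lemma na_ideal_principal s :
  center s -> na_ideal [set u | exists t, u = t ** s].
Proof.
move=> cs; split=> [|u v [t ->] [t' ->]|r u [t ->]|r u [t ->]].
- by exists 0; rewrite namul0r.
- by exists (t - t'); rewrite namulBl.
- by exists (r ** t); rewrite (centerAr _ _ cs).
- by exists (t ** r); rewrite (centerAm _ _ cs) (centerC r cs) (centerAr _ _ cs).
Qed.

Lemma na_idealD J s t : na_ideal J -> J s -> J t -> J (s + t).
Proof.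
case=> J0 JB _ _ Js Jt; rewrite -[t]opprK; apply: (JB) => //.
by rewrite -sub0r; apply: JB.
Qed.

Lemma na_ideal_sum J (I : eqType) (r : seq I) (F : I -> T) :
  na_ideal J -> (forall i, i \in r -> J (F i)) -> J (\sum_(i <- r) F i).
Proof.
move=> Jid JF; rewrite big_seq; apply: (big_ind J) => //; first by case: Jid.
by move=> x y; apply: na_idealD.
Qed.

Lemma na_ideal_oneT J : na_ideal J -> J 1 -> J = setT.
Proof.
by case=> _ _ Jl _ J1; apply/seteqP; split=> // r _; rewrite -[r]mulg1; apply: Jl.
Qed.

End NonAssociativeRing.

(** * Arithmetic of the Ore monoid ring *)

Section OreRingTheory.
Variables (R : naRingType) (G : monoidType) (pi : oreFamily R G).
Local Notation S := (oreRing pi).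
Implicit Types (a b c d f g h : G) (k p q r : R) (s t u v w : S).

(** Monomials and coefficients are retyped at the ring S: the multiplication
    of S lives on that name, not on the underlying free module. *)
Definition mono r a : S := << r *g a >>.
Definition coef t a : R := t@_a.

Local Notation "''C' r" := (mono r 1%g) (at level 8, r at level 2).
Local Notation "''X' a" := (mono 1%g a) (at level 8, a at level 2).

Lemma coefP s t : coef s =1 coef t -> s = t.
Proof. by move=> st; apply/malgP. Qed.

Lemma coefD s t a : coef (s + t) a = coef s a + coef t a.
Proof. exact: mcoeffD. Qed.

Lemma coefB s t a : coef (s - t) a = coef s a - coef t a.
Proof. exact: mcoeffB. Qed.

Lemma coef0 a : coef 0 a = 0.
Proof. exact: mcoeff0. Qed.

Lemma coef_sum (I : Type) (r : seq I) (F : I -> S) a :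
  coef (\sum_(i <- r) F i) a = \sum_(i <- r) coef (F i) a.
Proof. exact: (raddf_sum (mcoeff a)). Qed.

Lemma coef_mono r a b : coef (mono r a) b = if a == b then r else 0.
Proof. by rewrite /coef mcoeffU; case: eqP. Qed.

Lemma mono0 a : mono 0 a = 0.
Proof. exact: monalgU0. Qed.

Lemma mono_sum (I : Type) (e : seq I) (F : I -> R) a :
  mono (\sum_(i <- e) F i) a = \sum_(i <- e) mono (F i) a.
Proof. exact: (raddf_sum (mkmalgU a)). Qed.

Lemma monoE t : t = \sum_(c <- msupp t) mono (coef t c) c.
Proof. exact: monalgE. Qed.

Lemma ore_ind (P : S -> Prop) : P 0 ->
  (forall s t, P s -> P t -> P (s + t)) -> (forall r a, P (mono r a)) ->
  forall s, P s.
Proof.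
by move=> P0 PD PU s; rewrite [s]monoE; apply: (big_ind P) => // c _; apply: PU.
Qed.

Lemma mono11 : mono 1 1 = 1 :> S.
Proof. by []. Qed.

(** The finite set X of indices is a parameter so that several products can be
    expanded over one common set. *)
Lemma mono_mul r a q b (X : {fset G}) :
  (forall c, c \notin X -> pi a c q = 0) ->
  mono r a ** mono q b = \sum_(c <- X) mono (r ** pi a c q) (c * b)%g.
Proof. by move=> Xs; rewrite -(ore_mulUE r b Xs); apply: ore_mulUU. Qed.

(** Only the value of the maps pi^a_c at k matters, so this covers both k = 1,
    by D2, and a = 1, by D1, besides invariant k. *)
Lemma mono_mul_inv r a k b : (forall c, pi a c k = if a == c then k else 0) ->
  mono r a ** mono k b = mono (r ** k) (a * b)%g.
Proof.
move=> ka; rewrite (@mono_mul _ _ _ _ [fset a]%fset) => [|c].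
  by rewrite big_seq_fset1 ka eqxx.
by rewrite in_fset1 eq_sym ka => /negPf ->.
Qed.

Lemma mono_mulX r a b : mono r a ** 'X b = mono r (a * b)%g.
Proof. by rewrite mono_mul_inv ?mulg1 // => c; rewrite oreD2. Qed.

Lemma mono_mulC r q b : 'C r ** mono q b = mono (r ** q) b.
Proof.
rewrite mono_mul_inv ?mul1g // => c; have [D1 D1'] := oreD1 pi.
by case: eqP => [<-//|c1]; apply: D1' => /esym.
Qed.

Lemma monoCX r a : mono r a = 'C r ** 'X a.
Proof. by rewrite mono_mulX mul1g. Qed.

Lemma coef_Cmul r t a : coef ('C r ** t) a = r ** coef t a.
Proof.
elim/ore_ind: t => [|s t IHs IHt|q b].
- by rewrite namulr0 !coef0 namulr0.
- by rewrite namulDr !coefD namulDr IHs IHt.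
- by rewrite mono_mulC !coef_mono; case: eqP => //; rewrite namulr0.
Qed.

Lemma coef_mulC t r a :
  coef (t ** 'C r) a = \sum_(b <- msupp t) (coef t b ** pi b a r).
Proof.
rewrite {1}[t]monoE namul_suml coef_sum; apply: eq_bigr => b _.
have [X Xs] := ore_supp pi b r.
rewrite (mono_mul _ _ Xs) coef_sum.
under eq_bigr do rewrite mulg1 coef_mono.
case: (boolP (a \in X)) => aX.
  rewrite (big_fsetD1 a) //= eqxx big1_fset ?addr0 // => c.
  by rewrite in_fsetD1 => /andP[/negPf ->].
rewrite (Xs _ aX) namulr0 big1_seq // => c /andP[_ cX].
by case: eqP => // ca; rewrite ca (negPf aX) in cX.
Qed.

(** Gives one finite set of indices for a finite family of scalars, as needed
    to exchange the order of double sums. *)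
Lemma ore_supp_seq a (A : {fset G}) (F : G -> R) :
  exists X : {fset G}, forall b c, b \in A -> c \notin X -> pi a c (F b) = 0.
Proof.
have [X XP] := choice (fun b => ore_supp pi a (F b)).
exists (\bigcup_(b <- A) X b)%fset => b c bA cX; apply: XP.
by apply: contra cX => cXb; apply/bigfcupP; exists b; rewrite ?bA.
Qed.

(** The sum in D4 runs over the fibre of the product above c, which may be
    infinite; here it is cut down to the rectangle H x F, where all nonzero
    terms lie. *)
Lemma ore_D4_fset a b c r (F H : {fset G}) :
    (forall f, f \notin F -> pi b f r = 0) ->
    (forall f h, f \in F -> h \notin H -> pi a h (pi b f r) = 0) ->
  pi (a * b)%g c r =
  \sum_(h <- H) \sum_(f <- F) if (h * f)%g == c then pi a h (pi b f r) else 0.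
Proof.
move=> Fs Hs; rewrite oreD4.
pose X := [seq (h, f) | h <- enum_fset H, f <- enum_fset F].
rewrite (fsbigE [seq p <- X | p.1 * p.2 == c]) /=.
- rewrite big_filter_cond big_mkcond big_allpairs_dep /=.
  apply: eq_bigr => h _; apply: eq_bigr => f _.
  by case: eqP => // hf; rewrite mem_set.
- apply/filter_uniq/allpairs_uniq; rewrite ?fset_uniq // => -[? ?] [? ?] _ _.
  by case=> -> ->.
- by move=> [h f] /=; rewrite mem_filter => /andP[/eqP].
- move=> [h f] /= hf; rewrite mem_filter /= hf eqxx /= => hfX.
  case: (boolP (f \in F)) => [fF|/Fs ->]; last exact: ore_map0.
  by apply: (Hs f) => //; apply: contra hfX => hH; apply/allpairsP; exists (h, f).
Qed.

(** Right multiplication by x^b just shifts exponents, because pi^a_c(1) is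
    the Kronecker delta. *)
Lemma X_right_nucleus u v b : u ** v ** 'X b = u ** (v ** 'X b).
Proof.
elim/ore_ind: u => [|u u' IHu IHu'|r a].
- by rewrite !namul0r.
- by rewrite !namulDl IHu IHu'.
elim/ore_ind: v => [|v v' IHv IHv'|q c].
- by rewrite !namul0r namulr0 namul0r.
- by rewrite namulDl !namulDr namulDl IHv IHv'.
have [X Xs] := ore_supp pi a q.
rewrite mono_mulX !(mono_mul _ _ Xs) namul_suml; apply: eq_bigr => d _.
by rewrite mono_mulX mulgA.
Qed.

(** On monomials r x^a and q x^g both sides are sums of terms
    r pi^a_h(pi^b_f(q)) x^(hfg): the right side over all pairs (h, f), the left
    side with the pairs grouped by c = hf, which is what D4 expresses. *)
Lemma X_middle_nucleus u v b : u ** 'X b ** v = u ** ('X b ** v).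
Proof.
elim/ore_ind: u => [|u u' IHu IHu'|r a].
- by rewrite !namul0r.
- by rewrite !namulDl IHu IHu'.
elim/ore_ind: v => [|v v' IHv IHv'|q g].
- by rewrite !namulr0.
- by rewrite !namulDr IHv IHv'.
have [F Fs] := ore_supp pi b q.
have [H Hs] := ore_supp_seq a F (fun f => pi b f q).
rewrite mono_mulX (mono_mul _ _ Fs) namul_sumr.
pose C := [fset h * f | h in H, f in F]%fset.
have piE c := ore_D4_fset c Fs Hs.
have Cs c : c \notin C -> pi (a * b)%g c q = 0.
  move=> cC; rewrite piE big1_seq // => h /= hH; rewrite big1_seq // => f /= fF.
  by case: eqP => // hf; rewrite -hf in_imfset2 in cC.
rewrite (mono_mul _ _ Cs).
under eq_bigr => c _ do rewrite piE.
transitivity (\sum_(f <- F) \sum_(h <- H)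
    mono (r ** pi a h (pi b f q)) (h * (f * g))%g); last first.
  rewrite [LHS]big_seq [RHS]big_seq; apply: eq_bigr => f fF.
  by rewrite mul1g (mono_mul _ _ (Hs f ^~ fF)).
rewrite exchange_big /=.
transitivity (\sum_(h <- H) \sum_(f <- F) \sum_(c <- C)
    if (h * f)%g == c then mono (r ** pi a h (pi b f q)) (h * (f * g))%g else 0).
  under [RHS]eq_bigr do rewrite exchange_big /=.
  rewrite [RHS]exchange_big /=; apply: eq_bigr => c _.
  rewrite namul_sumr mono_sum; apply: eq_bigr => h _.
  rewrite namul_sumr mono_sum; apply: eq_bigr => f _.
  case: eqP => [<-|_]; first by rewrite mulgA.
  by rewrite namulr0 mono0.
rewrite [LHS]big_seq [RHS]big_seq; apply: eq_bigr => h hH.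
rewrite [LHS]big_seq [RHS]big_seq; apply: eq_bigr => f fF.
rewrite (big_fsetD1 (h * f)%g) ?in_imfset2 //= eqxx big1_fset ?addr0 // => c.
by rewrite in_fsetD1 eq_sym => /andP[/negPf ->].
Qed.

Lemma coef_ext a b s c : coef (ore_ext a b s) c = pi a b (coef s c).
Proof. exact: ore_extE. Qed.

Lemma ore_extD a b s t : ore_ext a b (s + t) = ore_ext a b s + ore_ext a b t :> S.
Proof. by apply: coefP => c; rewrite coefD !coef_ext coefD oreD3. Qed.

Lemma ore_ext0 a b : ore_ext a b 0 = 0 :> S.
Proof. by apply: coefP => c; rewrite coef_ext !coef0 ore_map0. Qed.

Lemma ore_extB a b s t : ore_ext a b (s - t) = ore_ext a b s - ore_ext a b t :> S.
Proof. by apply/eqP; rewrite eq_sym subr_eq -ore_extD subrK. Qed.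

Lemma ore_ext_mono a b r c : ore_ext a b (mono r c) = mono (pi a b r) c.
Proof. exact: ore_extU. Qed.

Lemma ore_ext_sum (I : Type) (e : seq I) (F : I -> S) a b :
  ore_ext a b (\sum_(i <- e) F i) = \sum_(i <- e) ore_ext a b (F i) :> S.
Proof.
exact: (big_morph (fun s : S => ore_ext a b s : S) (ore_extD a b) (ore_ext0 a b)).
Qed.

Lemma ore_ext_supp b t :
  exists X : {fset G}, forall f, f \notin X -> ore_ext b f t = 0 :> S.
Proof.
have [X Xs] := ore_supp_seq b (msupp t) (coef t).
exists X => f fX; apply: coefP => c; rewrite coef_ext coef0.
case: (boolP (c \in msupp t)) => [ct|ct]; first exact: Xs.
by rewrite /coef (mcoeff_outdom ct) ore_map0.
Qed.

Lemma invariants_coef s a : invariants (@ore_ext R G pi) s -> invariants pi (coef s a).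
Proof.
by move=> si b c; rewrite -coef_ext si; case: eqP => // _; rewrite coef0.
Qed.

(** Both sides are sums of pi^b_f(t_c) times a power of x, namely x^(fc) on
    the left and x^(cf) on the right. *)
Lemma mulX_ext b t (X : {fset G}) : (forall x y : G, x * y = y * x)%g ->
  (forall f, f \notin X -> ore_ext b f t = 0) ->
  'X b ** t = \sum_(f <- X) (ore_ext b f t ** 'X f).
Proof.
move=> GC Xs; rewrite {1}[t]monoE namul_sumr.
under [RHS]eq_bigr => f _.
  rewrite {1}[t]monoE ore_ext_sum namul_suml.
  under eq_bigr do rewrite ore_ext_mono mono_mulX GC.
  over.
rewrite [RHS]exchange_big /=; apply: eq_bigr => c _.
rewrite (@mono_mul _ _ _ _ X) => [|f fX].
  by apply: eq_bigr => f _; rewrite mul1g.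
by rewrite -coef_ext (Xs _ fX) coef0.
Qed.

(** The coefficients of s being invariant, multiplying by s on the right
    multiplies coefficients on the right by invariant scalars. *)
Lemma ore_ext_mulr a b s t : axiomD8 pi -> invariants (@ore_ext R G pi) s ->
  ore_ext a b (t ** s) = ore_ext a b t ** s :> S.
Proof.
move=> D8 si; elim/ore_ind: t => [|t u IHt IHu|r c].
- by rewrite namul0r ore_ext0 namul0r.
- by rewrite namulDl !ore_extD namulDl IHt IHu.
rewrite ore_ext_mono [s]monoE !namul_sumr ore_ext_sum; apply: eq_bigr => d _.
have kd := invariants_coef d si.
by rewrite !mono_mul_inv // ore_ext_mono D8.
Qed.

(** Multiplying by s on the left applies maps pi^d_f to t as well, so these
    have to commute with pi^a_b; D7 then handles the coefficients of s. *)
Lemma ore_ext_mull a b s t : axiomD7 pi -> commutative_family pi ->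
  invariants (@ore_ext R G pi) s ->
  ore_ext a b (s ** t) = s ** ore_ext a b t :> S.
Proof.
move=> D7 piC si; elim/ore_ind: t => [|t u IHt IHu|r c].
- by rewrite namulr0 ore_ext0 namulr0.
- by rewrite namulDr !ore_extD namulDr IHt IHu.
rewrite ore_ext_mono [s]monoE !namul_suml ore_ext_sum; apply: eq_bigr => d _.
have kd := invariants_coef d si.
have [X Xs] := ore_supp pi d r.
rewrite (mono_mul _ _ Xs) (@mono_mul _ _ _ _ X) => [|f fX]; last first.
  by rewrite piC (Xs _ fX) ore_map0.
rewrite ore_ext_sum; apply: eq_bigr => f _.
by rewrite ore_ext_mono D7 // piC.
Qed.

Definition right_linear_or_commutative :=
  axiomD8 pi \/ (axiomD7 pi /\ commutative_family pi).

(** For s commuting with S, left and right linearity say the same thing, which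
    makes the two alternatives interchangeable from here on. *)
Lemma ore_ext_mul_comm a b s t : right_linear_or_commutative ->
    invariants (@ore_ext R G pi) s -> (forall u, s ** u = u ** s) ->
  ore_ext a b (t ** s) = ore_ext a b t ** s :> S.
Proof.
case=> [D8|[D7 piC]] si sC; first exact: ore_ext_mulr.
by rewrite -sC ore_ext_mull // sC.
Qed.

(** Each law is first extended from scalars to all of S in its last free
    argument, by writing it as a sum of products q x^d and using that x^d is in
    the right and middle nucleus; the same factorization then treats the first
    argument. *)
Lemma center_of_scalars s : (forall x y : G, x * y = y * x)%g ->
    right_linear_or_commutative -> invariants (@ore_ext R G pi) s ->
    (forall r, s ** 'C r = 'C r ** s) ->
    (forall r q, s ** 'C r ** 'C q = s ** ('C r ** 'C q)) ->
    (forall r q, 'C r ** 'C q ** s = 'C r ** ('C q ** s)) ->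
  center s.
Proof.
move=> GC piL si sC sAl sAr.
have sX b : s ** 'X b = 'X b ** s.
  rewrite [s]monoE namul_suml namul_sumr; apply: eq_bigr => c _.
  rewrite mono_mulX mono_mul_inv ?mul1g 1?GC //.
  exact: (invariants_coef c si).
have s_comm t : s ** t = t ** s.
  elim/ore_ind: t => [|t u IHt IHu|r b].
  - by rewrite namul0r namulr0.
  - by rewrite namulDl namulDr IHt IHu.
  by rewrite [mono r b]monoCX -X_right_nucleus sC X_right_nucleus sX X_middle_nucleus.
have sCAl r u : s ** 'C r ** u = s ** ('C r ** u).
  elim/ore_ind: u => [|u v IHu IHv|q d].
  - by rewrite !namulr0.
  - by rewrite !namulDr IHu IHv.
  by rewrite [mono q d]monoCX -!X_right_nucleus sAl.
have sCAr r u : 'C r ** u ** s = 'C r ** (u ** s).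
  elim/ore_ind: u => [|u v IHu IHv|q d].
  - by rewrite !(namulr0, namul0r).
  - by rewrite namulDr !namulDl namulDr IHu IHv.
  by rewrite [mono q d]monoCX -!X_right_nucleus !X_middle_nucleus -!sX -!X_right_nucleus sAr.
have sXAr b u : 'X b ** u ** s = 'X b ** (u ** s).
  (* Linearity makes a support for u also one for u ** s, so both sides
     expand over the same set of exponents. *)
  have [X Xs] := ore_ext_supp b u.
  rewrite (mulX_ext GC Xs) (mulX_ext (t := u ** s) (X := X) GC) => [|f fX]; last first.
    by rewrite ore_ext_mul_comm // (Xs _ fX) namul0r.
  rewrite namul_suml; apply: eq_bigr => f _.
  by rewrite ore_ext_mul_comm // X_middle_nucleus -sX X_right_nucleus.
apply: center_intro => // t u.
- elim/ore_ind: t => [|t v IHt IHv|r b].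
  + by rewrite !(namulr0, namul0r).
  + by rewrite namulDr !namulDl namulDr IHt IHv.
  by rewrite [mono r b]monoCX -X_right_nucleus !X_middle_nucleus sCAl.
- elim/ore_ind: t => [|t v IHt IHv|r b].
  + by rewrite !namul0r.
  + by rewrite !namulDl IHt IHv.
  by rewrite [mono r b]monoCX !X_middle_nucleus sCAr sXAr.
Qed.

Lemma coefficientwise_ideal (J : set R) : na_ideal J -> G_invariant pi J ->
  na_ideal [set t : S | forall a, J (coef t a)].
Proof.
move=> Jid Jinv; have [J0 JB Jl Jr] := Jid.
have Jmono r a b : J r -> J (coef (mono r a) b).
  by rewrite coef_mono; case: eqP.
split=> [a|s t Js Jt a|t s Js a|t s Js a] /=.
- by rewrite coef0.
- by rewrite coefB; apply: JB.
- rewrite [s]monoE namul_sumr coef_sum; apply: na_ideal_sum => // b _.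
  elim/ore_ind: t => [|t u IHt IHu|r c].
  + by rewrite namul0r coef0.
  + by rewrite namulDl coefD; apply: na_idealD.
  have [X Xs] := ore_supp pi c (coef s b).
  rewrite (mono_mul _ _ Xs) coef_sum; apply: na_ideal_sum => // d _.
  by apply/Jmono/Jl/Jinv/Js.
- rewrite [s]monoE namul_suml coef_sum; apply: na_ideal_sum => // b _.
  elim/ore_ind: t => [|t u IHt IHu|q c].
  + by rewrite namulr0 coef0.
  + by rewrite namulDr coefD; apply: na_idealD.
  have [X Xs] := ore_supp pi b q.
  rewrite (mono_mul _ _ Xs) coef_sum; apply: na_ideal_sum => // d _.
  exact/Jmono/Jr/Js.
Qed.

(** * Leading terms and the minimal monic element *)

Section LeadingTerms.
Variable le : rel G.
Hypothesis le_wo : wochoice.well_order le.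
Hypothesis pi_le : forall a b, le a b -> a <> b -> forall r, pi a b r = 0.
Hypothesis pi_D6 : axiomD6 pi.

Lemma le_chain : wo_chain le predT.
Proof. by move=> A _; apply: le_wo. Qed.

Lemma le_total : total le.
Proof. by move=> a b; apply: (wo_chainW le_chain). Qed.

Lemma le_anti : antisymmetric le.
Proof. by move=> a b; apply: (wo_chain_antisymmetric le_chain). Qed.

(** Among a, b and c the least element is comparable to all three; if it is b
    or c, antisymmetry collapses the chain. *)
Lemma le_trans : transitive le.
Proof.
move=> b a c ab bc.
have [|z [[zA zle] _]] := le_wo (A := [pred x | x \in [:: a; b; c]]).
  by exists a; rewrite !inE eqxx.
have za : le z a by apply: zle; rewrite !inE eqxx.
have zb : le z b by apply: zle; rewrite !inE eqxx orbT.
have zc : le z c by apply: zle; rewrite !inE eqxx !orbT.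
move: zA; rewrite !inE => /or3P[]/eqP zE; rewrite zE in za zb zc => //.
- by rewrite (le_anti (introT andP (conj ab za))).
- by rewrite -(le_anti (introT andP (conj bc zb))).
Qed.

(** The bound need not be attained, which makes these sets closed under
    subtraction; the zero element satisfies it for every a. *)
Definition deg_le a t := forall c, coef t c <> 0 -> le c a.

Lemma deg_exists t : t <> 0 -> exists a, deg_le a t /\ coef t a <> 0.
Proof.
have seq_max (x : G) (e : seq G) :
    exists2 m, m \in x :: e & forall y, y \in x :: e -> le y m.
  elim: e x => [|y e IHe] x.
    exists x => [|y]; rewrite inE // => /eqP ->.
    by have := le_total x x; rewrite orbb.
  have [m me mmax] := IHe y; have [xm|mx] := orP (le_total x m).
    exists m; first by rewrite inE me orbT.
    by move=> z; rewrite inE => /predU1P[->|/mmax].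
  exists x; first by rewrite mem_head.
  move=> z; rewrite inE => /predU1P[->|/mmax zm]; last exact: le_trans mx.
  by have := le_total x x; rewrite orbb.
have supp c : coef t c <> 0 -> c \in msupp t.
  by move/eqP; rewrite /coef mcoeff_neq0.
case tE: (enum_fset (msupp t)) => [|x e].
  case; apply: coefP => c; rewrite coef0; apply: contrapT => /supp.
  by rewrite -[c \in msupp t]/(c \in enum_fset _) tE.
have [m me mmax] := seq_max x e; rewrite -tE in me mmax.
exists m; split=> [c /supp /mmax //|]; apply/eqP.
by rewrite /coef mcoeff_neq0.
Qed.

Lemma deg_leB a s t : deg_le a s -> deg_le a t -> deg_le a (s - t).
Proof.
move=> sa ta c; rewrite coefB => st0; have [s0|/eqP /sa //] := eqVneq (coef s c) 0.
by apply: ta => t0; apply: st0; rewrite s0 t0 subrr.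
Qed.

Lemma deg_le_Cmul a t r : deg_le a t -> deg_le a ('C r ** t).
Proof.
by move=> ta c; rewrite coef_Cmul => rt; apply: ta => t0; apply: rt; rewrite t0 namulr0.
Qed.

Lemma deg_le_ext a t b c : deg_le a t -> deg_le a (ore_ext b c t).
Proof.
move=> ta d; rewrite coef_ext => rt; apply: ta => t0.
by apply: rt; rewrite t0 ore_map0.
Qed.

(** The monomials of t_b x^b r have exponents c with pi^b_c nonzero, hence
    c at most b. *)
Lemma deg_le_mulC a t r : deg_le a t -> deg_le a (t ** 'C r).
Proof.
move=> ta c; rewrite coef_mulC => tc; apply: contrapT => ca; case: tc.
rewrite big1 // => b _; have [t0|/eqP /ta ba] := eqVneq (coef t b) 0.
  by rewrite t0 namul0r.
rewrite pi_le ?namulr0 => [//| |bc]; last by case: ca; rewrite -bc.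
by have [//|cb] := orP (le_total b c); case: ca; apply: le_trans ba.
Qed.

(** Among the terms of t, only the one at x^a can contribute to x^a, since
    pi^b_a = 0 for b < a; it contributes t_a pi^a_a(r), and D6 applies. *)
Lemma lead_mulC a t r : deg_le a t -> coef (t ** 'C r) a = coef t a ** r.
Proof.
move=> ta; rewrite coef_mulC.
have z b : b != a -> coef t b ** pi b a r = 0.
  move=> /eqP ba; have [t0|/eqP /ta lba] := eqVneq (coef t b) 0.
    by rewrite t0 namul0r.
  by rewrite pi_le ?namulr0.
case: (boolP (a \in msupp t)) => asupp.
  rewrite (big_fsetD1 a) //= pi_D6 big1_fset ?addr0 // => b.
  by rewrite in_fsetD1 => /andP[/z].
rewrite {2}/coef (mcoeff_outdom asupp) namul0r big1_seq // => b /andP[_ bt].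
by apply: z; apply: contraNneq asupp => <-.
Qed.

(** Take the least leading exponent a of elements of I.  The coefficients at
    x^a of the elements of I of degree at most a form a G-invariant ideal of R,
    nonzero by the choice of a, hence containing 1. *)
Lemma minimal_monic (I : set S) :
    na_ideal I -> G_invariant (@ore_ext R G pi) I -> I <> [set 0] -> G_simple pi ->
  exists s a, [/\ I s, deg_le a s, coef s a = 1%g
    & forall t, I t -> deg_le a t -> coef t a = 0 -> t = 0].
Proof.
move=> Iid Iinv I0 Rsimple; have [Iz IB Il Ir] := Iid.
pose D := [pred a | `[< exists t, [/\ I t, deg_le a t & coef t a <> 0] >]].
have [|a [[/asboolP[t0 [It0 t0a t0n]] amin] _]] := le_wo (A := D).
  apply: contrapT => Dn; apply: I0; apply/seteqP; split=> [t It|_ ->] //=.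
  have [//|/eqP/deg_exists[a [ta tn]]] := eqVneq t 0; case: Dn.
  by exists a; apply/asboolP; exists t.
have a_min t : I t -> deg_le a t -> coef t a = 0 -> t = 0.
  move=> It ta ta0; have [//|/eqP/deg_exists[b [tb tn]]] := eqVneq t 0.
  have ba : b = a.
    by apply: le_anti; rewrite ta //= amin //; apply/asboolP; exists t.
  by rewrite ba in tn.
pose J := [set r | exists t, [/\ I t, deg_le a t & coef t a = r]].
have Jid : na_ideal J.
  split=> [|_ _ [t [It ta <-]] [u [Iu ua <-]]|r _ [t [It ta <-]]|r _ [t [It ta <-]]].
  - by exists 0; split=> // [c|]; rewrite coef0.
  - by exists (t - u); rewrite coefB; split; [apply: IB|apply: deg_leB|].
  - by exists ('C r ** t); rewrite coef_Cmul; split; [apply: Il|apply: deg_le_Cmul|].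
  - by exists (t ** 'C r); rewrite lead_mulC //; split; [apply: Ir|apply: deg_le_mulC|].
have Jinv : G_invariant pi J.
  move=> b c _ [t [It ta <-]].
  by exists (ore_ext b c t); rewrite coef_ext; split; [apply: Iinv|apply: deg_le_ext|].
have [J0|JT] := Rsimple J Jid Jinv.
  by case: t0n; suff : [set 0] (coef t0 a) by []; rewrite -J0; exists t0.
have [s [Is sa s1]] : J 1%g by rewrite JT.
by exists s, a.
Qed.

(** Two elements of I of degree at most a with the same coefficient at x^a are
    equal.  Both sides of each identity to be proved are such elements, their
    coefficients at x^a being computed from s_a = 1. *)
Lemma minimal_monic_central (I : set S) s a :
    (forall x y : G, x * y = y * x)%g -> right_linear_or_commutative ->
    na_ideal I -> G_invariant (@ore_ext R G pi) I ->
    I s -> deg_le a s -> coef s a = 1%g ->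
    (forall t, I t -> deg_le a t -> coef t a = 0 -> t = 0) ->
  @invariant_center R G pi s.
Proof.
move=> GC piL [I0 IB Il Ir] Iinv Is sa s1 a_min.
have eqI t u : I t -> I u -> deg_le a t -> deg_le a u ->
    coef t a = coef u a -> t = u.
  move=> It Iu ta ua tu; apply/subr0_eq/a_min; first exact: IB.
    exact: deg_leB.
  by rewrite coefB tu subrr.
have si : invariants (@ore_ext R G pi) s.
  move=> b c; case: eqP => bc.
    by apply: eqI => //; [exact: Iinv|exact: deg_le_ext|rewrite coef_ext bc pi_D6].
  apply: a_min; [exact: Iinv|exact: deg_le_ext|].
  by rewrite coef_ext s1 oreD2; case: eqP.
split=> //; apply: center_of_scalars => // [r|r q|r q]; apply: eqI.
(* The coefficient equations close by computation; what remains is membership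
   in I and the degree bounds. *)
all: rewrite ?(lead_mulC, coef_Cmul, mono_mulC, s1, mulg1, mul1g) //.
all: first [by repeat apply: (Il) | by repeat apply: (Ir)
  | by repeat first [apply: deg_le_Cmul | apply: deg_le_mulC]].
Qed.

End LeadingTerms.

(** * The two directions *)

Lemma coefficient_ring_simple :
  G_simple (@ore_ext R G pi) -> G_simple pi.
Proof.
move=> Ssimple J Jid Jinv.
have [|J0|JT] := Ssimple _ (coefficientwise_ideal Jid Jinv).
- by move=> a b t Jt c; rewrite coef_ext; apply/Jinv/Jt.
- left; apply/seteqP; split=> [r Jr|_ ->]; last by case: Jid.
  have : [set t : S | forall a, J (coef t a)] (mono r 1%g).
    by move=> b; rewrite coef_mono; case: eqP => // _; case: Jid.
  by rewrite J0 => /(congr1 (coef ^~ 1%g)); rewrite coef_mono eqxx coef0.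
- right; apply: na_ideal_oneT => //.
  have : [set t : S | forall a, J (coef t a)] (mono 1 1%g) by rewrite JT.
  by move=> /(_ 1%g); rewrite coef_mono eqxx.
Qed.

Lemma invariants_one : invariants (@ore_ext R G pi) (1%g : S).
Proof.
move=> a b; rewrite -mono11 ore_ext_mono oreD2.
by case: eqP => // _; rewrite mono0.
Qed.

(** A nonzero s in K generates S as a G-invariant ideal, so it has an inverse
    t.  Invariance of t follows by cancelling s: pi~(t) s = pi~(t s) = pi~(1). *)
Lemma invariant_center_field : right_linear_or_commutative ->
  (1%g : R) <> 0 -> G_simple (@ore_ext R G pi) -> is_subfield (@invariant_center R G pi).
Proof.
move=> piL R10 Ssimple.
have extM s t a b : @invariant_center R G pi s ->
    ore_ext a b (t ** s) = ore_ext a b t ** s :> S.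
  by move=> [cs si]; apply: ore_ext_mul_comm => // u; apply: centerC.
split.
- split; first by split; [exact: center_one|exact: invariants_one].
  by rewrite -mono11 => /(congr1 (coef ^~ 1%g)); rewrite coef_mono eqxx coef0.
- move=> s t Ks Kt; have [cs si] := Ks; have [ct ti] := Kt; split; split.
  + exact: center_sub.
  + by move=> a b; rewrite ore_extB si ti; case: eqP => // _; rewrite subr0.
  + exact: center_mul.
  + by move=> a b; rewrite extM // si; case: eqP => // _; rewrite namul0r.
- by move=> s t u _ _ [cu _]; rewrite (centerAr _ _ cu).
- by move=> s t [cs _] _; apply: centerC.
move=> s Ks s0; have [cs si] := Ks.
have [|P0|PT] := Ssimple _ (na_ideal_principal cs).
- by move=> a b _ [t ->]; exists (ore_ext a b t); rewrite extM.
- by case: s0; suff : [set 0] s by []; rewrite -P0; exists 1%g; rewrite mul1g.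
have [t ts] : [set u | exists t, u = t ** s] 1%g by rewrite PT.
have st : s ** t = 1%g by rewrite (centerC t cs).
have ct : center t by apply: center_inv st.
exists t; split=> //; split=> // a b.
rewrite -[LHS]mulg1 -st -(centerAm _ _ cs) -extM // -ts invariants_one.
by case: eqP => _; rewrite ?mul1g ?namul0r.
Qed.

End OreRingTheory.

Theorem theorem18 (R : naRingType) (G : monoidType) (pi : oreFamily R G)
    (R_nontrivial : (1%g : R) <> 0%R)
    (G_comm : forall a b : G, (a * b = b * a)%g)
    (pi_D6 : axiomD6 pi)
    (pi_strong : strong pi)
    (pi_wo : well_ordered pi)
    (pi_D8_or_D7C : axiomD8 pi \/ (axiomD7 pi /\ commutative_family pi)) :
  G_simple (@ore_ext R G pi) <->
  G_simple pi /\ is_subfield (@invariant_center R G pi).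
Proof.
split=> [Ssimple|[Rsimple [_ _ _ _ Kinv]] I Iid Iinv].
  by split; [exact: coefficient_ring_simple|exact: invariant_center_field].
(* I meets the field of central invariants in a nonzero element s, whose
   inverse forces 1 into I. *)
have [I0|I0] := EM (I = [set 0]); [by left|right].
have [le le_wo pi_le] := pi_wo.
have [s [a [Is sa s1 a_min]]] := minimal_monic le_wo pi_le pi_D6 Iid Iinv I0 Rsimple.
have Ks : @invariant_center R G pi s.
  exact: (minimal_monic_central le_wo pi_le pi_D6 G_comm pi_D8_or_D7C
    Iid Iinv Is sa s1 a_min).
have [|t [_ st]] := Kinv s Ks.
  by move=> s0; apply: R_nontrivial; rewrite -s1 s0 coef0.
by apply: na_ideal_oneT => //; rewrite -st; case: Iid => _ _ _; apply.
Qed.
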